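(* a) For any $n\ge2$ and any monic polynomial $P(X)\in\mathcal{C}_n(\mathbb{R})$, its derivative $D(P(X))=Q(X)$ has $n-1$ distinct real roots and $Q(X)$ satisfies the inequality $m(Q)<M(Q)$. b) For $n\geq 2$, the image of the derivative $D:\mathcal{C}_n(\mathbb{R})\to\mathcal{C}_{n-1}(\mathbb{R})$ is the set $$Q\mathcal{C}_{n-1}(\mathbb{R})=\Big\{P'(X)\ \Big|\ P(X)=\prod_{i=1}^n(X-a_i),\ a_1<\dots<a_n\Big\}=\Big\{Q(X)=n\prod_{i=1}^{n-1}(X-b_i),\ b_1<\dots<b_{n-1}\ \Big|\ m(Q)<M(Q)\Big\},$$ an open subset of $\mathcal{C}_{n-1}(\mathbb{R})$. One has $Q\mathcal{C}_{n-1}(\mathbb{R})=\mathcal{C}_{n-1}(\mathbb{R})$ if and only if $n=2,3,4$. c) For any $n\ge2$ there is a homeomorphism $$D\times Ev_0:\ \mathcal{C}_n(\mathbb{R})\longrightarrow Q\mathcal{C}_{n-1}(\mathbb{R})\times(0,1),$$ where $$Ev_0(P)=\begin{cases}\dfrac{P(0)+m(P')}{P(0)+m(P')-1}&\text{if }n=2,\\[2mm]\dfrac{P(0)+M(P')}{M(P')-m(P')}&\text{if }n\geq3.\end{cases}$$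
   Context: $\mathcal{C}_n(\mathbb{R})=\{(x_1,\dots,x_n)\in\mathbb{R}^n\mid x_1<x_2<\dots<x_n\}$, identified with the monic real polynomials $\prod_{i=1}^n(X-x_i)$ with $n$ distinct real roots. A polynomial $Q(X)=n\prod_{i=1}^{n-1}(X-b_i)$ with $b_1<\dots<b_{n-1}$ is identified with the point $(b_1,\dots,b_{n-1})$ of $\mathcal{C}_{n-1}(\mathbb{R})$. $D$ is the derivative $P\mapsto P'$. For $n\ge3$, $Q(X)=n(X-b_1)\cdots(X-b_{n-1})$ with $b_1<\dots<b_{n-1}$ real, and $P(X)=\int_0^XQ(t)\,dt$, define $$m(Q)=\max\{P(b_k)\mid k=n-1,n-3,\dots;\ k\ge1\},\qquad M(Q)=\min\{P(b_k)\mid k=n-2,n-4,\dots;\ k\ge1\}.$$ For $n=2$ and $Q(X)=2(X-b)$, define $m(Q)=-b^2$ and $M(Q)=\infty$. *)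

(* Defs.v *)
From HB Require Import structures.
From mathcomp Require Import all_boot all_order all_algebra.
From mathcomp Require Import all_classical all_reals all_analysis.

Set Implicit Arguments.
Unset Strict Implicit.
Unset Printing Implicit Defensive.

Import Order.TTheory GRing.Theory Num.Theory.
Import numFieldNormedType.Exports.

Local Open Scope classical_set_scope.
Local Open Scope ring_scope.

(* Indices are shifted: the coordinate x_k (1 <= k <= n) is x ord0 i with k = i.+1. *)

Definition conf (R : realType) (n : nat) : set 'rV[R]_n :=
  [set x | forall i j : 'I_n, (i < j)%N -> x ord0 i < x ord0 j].
Arguments conf R n : clear implicits.

Definition Ppoly (R : realType) (n : nat) (x : 'rV[R]_n) : {poly R} :=
  \prod_(i < n) ('X - (x ord0 i)%:P).

Definition Qpoly (R : realType) (n : nat) (b : 'rV[R]_n.-1) : {poly R} :=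
  n%:R *: \prod_(i < n.-1) ('X - (b ord0 i)%:P).
(* n cannot be inferred from n.-1 *)
Arguments Qpoly {R} n b.

(* The oriented integral from 0 to x; the library only integrates over sets,
   so the sign for x < 0 has to be put in by hand. *)
Definition int0 (R : realType) (f : R -> R) (x : R) : R :=
  if 0 <= x then \int[lebesgue_measure]_(t in `[0, x]) f t
  else - \int[lebesgue_measure]_(t in `[x, 0]) f t.

Definition critval (R : realType) (n : nat) (b : 'rV[R]_n.-1) (i : 'I_n.-1) : R :=
  int0 (fun t => (Qpoly n b).[t]) (b ord0 i).
Arguments critval {R} n b i.

(* For n >= 3 the index set k = n-1, n-3, ..., that is n-1-k even with
   k = i.+1, is nonempty, so the neutral element -oo plays no role. *)
Definition mQ (R : realType) (n : nat) : 'rV[R]_n.-1 -> \bar R :=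
  match n return 'rV[R]_n.-1 -> \bar R with
  | 2%N => fun b => (- (b ord0 ord0) ^+ 2)%:E
  | n' => fun b =>
      \big[maxe/-oo%E]_(i < n'.-1 | ~~ odd (n'.-1 - i.+1)) (critval n' b i)%:E
  end.
Arguments mQ {R} n b.

(* Likewise k = n-2, n-4, ... means that n-1-k is odd. *)
Definition MQ (R : realType) (n : nat) : 'rV[R]_n.-1 -> \bar R :=
  match n return 'rV[R]_n.-1 -> \bar R with
  | 2%N => fun _ => +oo%E
  | n' => fun b =>
      \big[mine/+oo%E]_(i < n'.-1 | odd (n'.-1 - i.+1)) (critval n' b i)%:E
  end.
Arguments MQ {R} n b.

(* The derivative on configurations: D x is the b in C_{n-1} with
   (Ppoly x)' = Qpoly n b, and an arbitrary value if there is no such b. *)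
Definition D (R : realType) (n : nat) (x : 'rV[R]_n) : 'rV[R]_n.-1 :=
  get [set b : 'rV[R]_n.-1 | conf R n.-1 b /\ (Ppoly x)^`() = Qpoly n b].

Definition QC (R : realType) (n : nat) : set 'rV[R]_n.-1 :=
  [set b | conf R n.-1 b /\
           exists2 a : 'rV[R]_n, conf R n a & (Ppoly a)^`() = Qpoly n b].
Arguments QC R n : clear implicits.

Definition Ev0 (R : realType) (n : nat) (x : 'rV[R]_n) : R :=
  let p0 := (Ppoly x).[0] in
  let m := fine (mQ n (D x)) in
  let M := fine (MQ n (D x)) in
  if n == 2%N then (p0 + m) / (p0 + m - 1) else (p0 + M) / (M - m).

Definition homeomorphism_on (T U : topologicalType) (A : set T) (B : set U)
    (f : T -> U) : Prop :=
  [/\ set_fun A B f, {within A, continuous f} &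
      exists g : U -> T,
        [/\ set_fun B A g, {within B, continuous g},
            {in A, cancel f g} & {in B, cancel g f}]].

(* Main.v *)
Require Import Defs.
From HB Require Import structures.
From mathcomp Require Import all_boot all_order all_algebra.
From mathcomp Require Import all_classical all_reals all_analysis.
From mathcomp Require Import ring lra zify.
From mathcomp Require polyorder polyrcf.

Set Implicit Arguments.
Unset Strict Implicit.
Unset Printing Implicit Defensive.

Import Order.TTheory GRing.Theory Num.Theory.
Import numFieldNormedType.Exports.

Local Open Scope classical_set_scope.
Local Open Scope ring_scope.

(* Let [p0] be the antiderivative of [Q] vanishing at 0.  By the intermediate
   value theorem [p0 + c] has [n] distinct real roots exactly when its values at
   the [b_k] alternate in sign, which amounts to [m(Q) < - c < M(Q)]; conversely
   Rolle's theorem puts a root of [P'] between any two consecutive roots of [P].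
   Thus [(Q, c)] runs over an interval bundle above the set [m(Q) < M(Q)], and
   [Ev_0] rescales each fibre to (0, 1).  Both the map and its inverse are
   continuous because simple roots depend continuously on the coefficients: the
   sign changes on either side of each root persist under small perturbations.
   For [n = 2] the stated [m] and [M] are again the max and the min of the
   critical values, the min being over the empty set. *)

(** * Antiderivatives *)

(* At [i = 0] the coefficient is [p`_0 / 0 = 0]. *)
Definition poly_int (R : fieldType) (p : {poly R}) : {poly R} :=
  \poly_(i < (size p).+1) (p`_i.-1 / i%:R).

Lemma coef_poly_int (R : fieldType) (p : {poly R}) i :
  (poly_int p)`_i = p`_i.-1 / i%:R.
Proof.
rewrite coef_poly; case: ltnP => // sp.
by rewrite nth_default ?mul0r//; case: i sp.
Qed.

Lemma deriv_poly_int (R : numFieldType) (p : {poly R}) : (poly_int p)^`() = p.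
Proof.
apply/polyP => i; rewrite coef_deriv coef_poly_int /= -[LHS]mulr_natr.
by rewrite divfK ?pnatr_eq0.
Qed.

Lemma poly_int0 (R : fieldType) (p : {poly R}) : (poly_int p).[0] = 0.
Proof. by rewrite horner_coef0 coef_poly_int invr0 mulr0. Qed.

Lemma deriv_eq_inj (R : numFieldType) (p q : {poly R}) :
  p^`() = q^`() -> p.[0] = q.[0] -> p = q.
Proof.
move=> pq; rewrite !horner_coef0 => pq0; apply/polyP => -[//|i].
move/polyP: pq => /(_ i); rewrite !coef_deriv.
exact: pmulrnI.
Qed.

(** This is the correspondence between [P] and the pair [(Q, c)]: a polynomial is determined by its
    derivative and its value at 0. *)
Lemma poly_intE (R : numFieldType) (p : {poly R}) :
  p = poly_int p^`() + p.[0]%:P.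
Proof.
apply: deriv_eq_inj; first by rewrite derivD deriv_poly_int derivC addr0.
by rewrite hornerD poly_int0 hornerC add0r.
Qed.

(** The fundamental theorem of calculus, applied on [[0, x]] or [[x, 0]] according to the sign of
    [x]. From here on critical values are values of the formal antiderivative. *)
Lemma int0_horner (R : realType) (p : {poly R}) x :
  int0 (horner p) x = (poly_int p).[x].
Proof.
have ftc (a b : R) : a < b -> \int[lebesgue_measure]_(t in `[a, b]) p.[t] =
    (poly_int p).[b] - (poly_int p).[a].
  move=> ab; rewrite /Rintegral (@continuous_FTC2 _ _ (horner (poly_int p)))//.
  - by apply: continuous_subspaceT; exact: continuous_horner.
  - split; first by move=> y _; exact: derivable_horner.
      by apply: cvg_at_right_filter; exact: continuous_horner.
    by apply: cvg_at_left_filter; exact: continuous_horner.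
  - move=> y _; rewrite derive1E.
    by have [_ ->] := is_derive_poly (poly_int p) y; rewrite deriv_poly_int.
rewrite /int0; case: ltgtP => [x0|x0|<-].
- by rewrite ftc// poly_int0 subr0.
- by rewrite ftc// poly_int0 sub0r opprK.
- by rewrite set_itv1 Rintegral_set1 poly_int0.
Qed.

(** * Convergence of polynomials along a filter *)

Lemma cvg_rV (T : Type) (R : realType) n (F : set_system T) (FF : Filter F)
    (f : T -> 'rV[R]_n) (l : 'rV[R]_n) :
  (forall i, f x ord0 i @[x --> F] --> l ord0 i) -> f x @[x --> F] --> l.
Proof.
move=> fl A [P lP PA].
have : \forall x \near F, forall i, P ord0 i (f x ord0 i).
  by apply: filter_forall => i; exact: (fl i _ (lP _ _)).
by apply: filterS => x Px; apply: PA => i j; rewrite (ord1 i).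
Qed.

Lemma cvg_rV_coord (T : Type) (R : realType) n (F : set_system T)
    (FF : Filter F) (f : T -> 'rV[R]_n) (l : 'rV[R]_n) i :
  f x @[x --> F] --> l -> f x ord0 i @[x --> F] --> l ord0 i.
Proof.
move=> fl.
exact: (cvg_comp f (fun M : 'rV[R]_n => M ord0 i) fl (@coord_continuous _ _ _ ord0 i l)).
Qed.

(** Convergence of each coefficient separately; a uniform bound on the degrees is demanded only
    where polynomials are evaluated. *)
Definition poly_cvg (R : realType) (T : Type) (F : set_system T)
    (f : T -> {poly R}) (p : {poly R}) :=
  forall i, (f x)`_i @[x --> F] --> p`_i.

Lemma poly_cvg_cst (R : realType) (T : Type) (F : set_system T)
    (FF : Filter F) (p : {poly R}) : poly_cvg F (fun=> p) p.
Proof. by move=> i; exact: cvg_cst. Qed.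

Lemma poly_cvgD (R : realType) (T : Type) (F : set_system T) (FF : Filter F)
    (f g : T -> {poly R}) (p q : {poly R}) :
  poly_cvg F f p -> poly_cvg F g q -> poly_cvg F (fun x => f x + g x) (p + q).
Proof.
move=> fp gq i; rewrite coefD; under eq_fun do rewrite coefD.
by apply: cvgD; [exact: fp|exact: gq].
Qed.

Lemma poly_cvgC (R : realType) (T : Type) (F : set_system T) (FF : Filter F)
    (c : T -> R) (c0 : R) :
  c x @[x --> F] --> c0 -> poly_cvg F (fun x => (c x)%:P) c0%:P.
Proof.
move=> cc [|i]; rewrite coefC /=; under eq_fun do rewrite coefC /=.
  exact: cc.
exact: cvg_cst.
Qed.

Lemma poly_cvgM (R : realType) (T : Type) (F : set_system T) (FF : Filter F)
    (f g : T -> {poly R}) (p q : {poly R}) :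
  poly_cvg F f p -> poly_cvg F g q -> poly_cvg F (fun x => f x * g x) (p * q).
Proof.
move=> fp gq i; rewrite coefM; under eq_fun do rewrite coefM.
apply: cvg_big => [|j _]; first exact: add_continuous.
by apply: cvgM; [exact: fp|exact: gq].
Qed.

Lemma poly_cvg_Ppoly (R : realType) (T : Type) (F : set_system T)
    (FF : Filter F) n (f : T -> 'rV[R]_n) (r : 'rV[R]_n) :
  f x @[x --> F] --> r -> poly_cvg F (fun x => Ppoly (f x)) (Ppoly r).
Proof.
move=> fr; rewrite /Ppoly; elim: (index_enum _) => [|i s IHs].
  by rewrite big_nil; under eq_fun do rewrite big_nil; exact: poly_cvg_cst.
rewrite big_cons; under eq_fun do rewrite big_cons.
apply: poly_cvgM => //; apply: poly_cvgD; first exact: poly_cvg_cst.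
under eq_fun do rewrite -polyCN; rewrite -polyCN.
by apply: poly_cvgC; apply: cvgN; exact: cvg_rV_coord.
Qed.

Lemma poly_cvg_deriv (R : realType) (T : Type) (F : set_system T)
    (FF : Filter F) (f : T -> {poly R}) (p : {poly R}) :
  poly_cvg F f p -> poly_cvg F (fun x => (f x)^`()) p^`().
Proof.
move=> fp i; rewrite coef_deriv; under eq_fun do rewrite coef_deriv.
by apply: cvgMn; exact: fp.
Qed.

Lemma poly_cvg_int (R : realType) (T : Type) (F : set_system T)
    (FF : Filter F) (f : T -> {poly R}) (p : {poly R}) :
  poly_cvg F f p -> poly_cvg F (fun x => poly_int (f x)) (poly_int p).
Proof.
move=> fp i; rewrite coef_poly_int; under eq_fun do rewrite coef_poly_int.
by apply: cvgMr_tmp; exact: fp.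
Qed.

(** The common bound [N] turns evaluation into a sum of fixed length. The point [t x] may move too,
    as the critical points do. *)
Lemma poly_cvg_horner (R : realType) (T : Type) (F : set_system T)
    (FF : Filter F) (f : T -> {poly R}) (p : {poly R}) (t : T -> R) (t0 : R) N :
  (forall x, size (f x) <= N)%N -> (size p <= N)%N ->
  poly_cvg F f p -> t x @[x --> F] --> t0 ->
  (f x).[t x] @[x --> F] --> p.[t0].
Proof.
move=> sf sp fp tt0; rewrite (horner_coef_wide _ sp).
under eq_fun do rewrite (horner_coef_wide _ (sf _)).
apply: cvg_big => [|j _]; first exact: add_continuous.
apply: cvgM; first exact: fp.
exact: (cvg_comp t (fun y : R => y ^+ j) tt0 (@exprn_continuous R j t0)).
Qed.

(** * Interlacing and continuity of roots *)

Lemma horner_Ppoly (R : realType) n (x : 'rV[R]_n) t :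
  (Ppoly x).[t] = \prod_(i < n) (t - x ord0 i).
Proof.
rewrite /Ppoly horner_prod.
by apply: eq_bigr => i _; rewrite hornerXsubC.
Qed.

Lemma size_Ppoly (R : realType) n (x : 'rV[R]_n) : size (Ppoly x) = n.+1.
Proof. by rewrite /Ppoly size_prod_XsubC -[index_enum _]enumT size_enum_ord. Qed.

Lemma lead_coef_Ppoly (R : realType) n (x : 'rV[R]_n) : lead_coef (Ppoly x) = 1.
Proof. by apply/eqP/monic_prod_XsubC. Qed.

Lemma root_Ppoly (R : realType) n (x : 'rV[R]_n) t :
  root (Ppoly x) t = (t \in [seq x ord0 i | i : 'I_n]).
Proof.
rewrite rootE horner_Ppoly; apply/prodf_eq0/mapP => -[i].
  by move=> _; rewrite subr_eq0 => /eqP ->; exists i; rewrite ?mem_enum.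
by move=> _ ->; exists i => //; rewrite subrr.
Qed.

Lemma conf_sorted (R : realType) n (x : 'rV[R]_n) : conf R n x ->
  sorted <%R [seq x ord0 i | i : 'I_n].
Proof.
move=> cx; rewrite sorted_map.
have : sorted ltn (map val (enum 'I_n)) by rewrite val_enum_ord iota_ltn_sorted.
by rewrite sorted_map; apply: sub_sorted => i j; exact: cx.
Qed.

Lemma conf_le (R : realType) n (x : 'rV[R]_n) (i j : 'I_n) :
  conf R n x -> (i <= j)%N -> x ord0 i <= x ord0 j.
Proof.
move=> cx; rewrite leq_eqVlt => /predU1P[/val_inj->//|ij].
by rewrite ltW// cx.
Qed.

(** A strictly sorted list is determined by its members, which here are the roots. *)
Lemma Ppoly_inj (R : realType) n (x y : 'rV[R]_n) :
  conf R n x -> conf R n y -> Ppoly x = Ppoly y -> x = y.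
Proof.
move=> /conf_sorted cx /conf_sorted cy xy; apply/rowP => i.
have /eq_in_map -> // : [seq x ord0 i | i : 'I_n] = [seq y ord0 i | i : 'I_n].
  by apply: lt_sorted_eq => // t; rewrite -!root_Ppoly xy.
by rewrite mem_enum.
Qed.

Lemma conf_roots (R : realType) n (r : 'rV[R]_n) (p : {poly R}) :
  conf R n r -> size p = n.+1 -> (forall i, root p (r ord0 i)) ->
  p = lead_coef p *: Ppoly r.
Proof.
move=> cr sp rp.
rewrite [LHS](@all_roots_prod_XsubC _ _ [seq r ord0 i | i : 'I_n]).
- by rewrite big_image.
- by rewrite size_map size_enum_ord.
- by apply/allP => _ /mapP[i _ ->].
- by rewrite uniq_rootsE; exact: lt_sorted_uniq (conf_sorted cr).
Qed.

(** Exactly the factors [t - x ord0 j] with [k <= j] are negative, and there are [n - k] of them. *)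
Lemma Ppoly_sgn (R : realType) n (x : 'rV[R]_n) k t :
  (forall j : 'I_n, (j < k)%N -> x ord0 j < t) ->
  (forall j : 'I_n, (k <= j)%N -> t < x ord0 j) ->
  0 < (-1) ^+ (n - k) * (Ppoly x).[t].
Proof.
move=> xt tx; rewrite -prodr_const_nat big_geq_mkord big_mkcond /=.
rewrite horner_Ppoly -big_split /=; apply: prodr_gt0 => i _ /=.
case: leqP => ki; last by rewrite mul1r subr_gt0 xt.
by rewrite mulN1r opprB subr_gt0 tx.
Qed.

Lemma sign_change (R : realDomainType) k (x y : R) :
  0 < (-1) ^+ k.+1 * x -> 0 < (-1) ^+ k * y -> x * y < 0.
Proof.
move=> x0 y0; rewrite -oppr_gt0; have := mulr_gt0 x0 y0.
by rewrite mulrACA exprS mulN1r mulNr -expr2 sqrr_sign mulN1r.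
Qed.

(** The intermediate value theorem gives a root in each interval; as the intervals are ordered,
    these [n] roots are distinct and exhaust the degree. *)
Lemma interlace_roots (R : realType) n (p : {poly R}) (u v : 'I_n -> R) :
  size p = n.+1 -> (forall i, u i < v i) ->
  (forall i j : 'I_n, (i < j)%N -> v i <= u j) ->
  (forall i, p.[u i] * p.[v i] < 0) ->
  exists a : 'rV[R]_n,
    [/\ conf R n a, forall i, u i < a ord0 i < v i & p = lead_coef p *: Ppoly a].
Proof.
move=> sp uv vu puv.
have /fin_all_exists[r rP] : forall i, exists t, (u i < t < v i) && root p t.
  move=> i; have [t] := polyrcf.poly_ivtoo (ltW (uv i)) (puv i).
  by rewrite in_itv => /= tuv rt; exists t; rewrite tuv.
have cr : conf R n (\row_i r i).
  move=> i j ij; rewrite !mxE.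
  have /andP[/andP[_ ri] _] := rP i; have /andP[/andP[rj _] _] := rP j.
  exact: lt_trans ri (le_lt_trans (vu _ _ ij) rj).
exists (\row_i r i); split => //.
  by move=> i; rewrite mxE; case/andP: (rP i).
by apply: conf_roots => // i; rewrite mxE; case/andP: (rP i).
Qed.

Lemma poly_eventually_gt0 (R : realType) (p : {poly R}) : 0 < lead_coef p ->
  exists A, forall x, A <= x -> 0 < p.[x].
Proof.
move=> p0; have [A Ap] := polyrcf.poly_pinfty_gt_lc p0.
by exists A => x /Ap; exact: lt_le_trans.
Qed.

Lemma monic_eventually_sgn (R : realType) n (p : {poly R}) :
  p \is monic -> size p = n.+1 ->
  exists A, forall x, x <= A -> 0 < (-1) ^+ n * p.[x].
Proof.
move=> /monicP p1 sp.
(* Substituting [- 'X] moves the question to plus infinity; the factor [(-1) ^+ n] makes the leading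
   coefficient 1. *)
have [|A Ap] := @poly_eventually_gt0 _ ((-1) ^+ n *: (p \Po (- 'X))).
  rewrite lead_coefZ lead_coef_comp ?size_polyN ?size_polyX// lead_coefN.
  by rewrite lead_coefX p1 mul1r sp /= -exprMn mulrNN mulr1 expr1n ltr01.
exists (- A) => x xA; have := Ap (- x).
by rewrite hornerZ horner_comp hornerN hornerX opprK lerNr; exact.
Qed.

(** Adding a far left and a far right point to the [n] points of [b] yields [n.+2] points of
    alternating sign, hence [n.+1] sign changes. *)
Lemma alternating_roots (R : realType) n (p : {poly R}) (b : 'rV[R]_n) :
  p \is monic -> size p = n.+2 -> conf R n b ->
  (forall i : 'I_n, 0 < (-1) ^+ (n - i) * p.[b ord0 i]) ->
  exists2 a : 'rV[R]_n.+1, conf R n.+1 a & p = Ppoly a.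
Proof.
move=> pm sp cb pb.
have [A pA] := monic_eventually_sgn pm sp.
have [|B pB] := @poly_eventually_gt0 _ p; first by rewrite (monicP pm) ltr01.
pose lo := \big[Num.min/A]_(i < n) b ord0 i - 1.
(* The term [lo + 1] ensures [lo < hi] even for [n = 0], when no [b ord0 i] lies between them. *)
pose hi := Num.max (lo + 1) (\big[Num.max/B]_(i < n) b ord0 i + 1).
have lob i : lo < b ord0 i.
  by have := bigmin_le A i (b ord0); rewrite /lo; lra.
have bhi i : b ord0 i < hi.
  by rewrite lt_max; have := le_bigmax B (b ord0) i; lra.
have lohi : lo < hi by rewrite lt_max ltrDl ltr01.
(* The list [lo], the entries of [b], [hi], with indices shifted by one; [insub] fails just beyond
   the last entry and then [hi] is returned. *)
pose w k := if k is k'.+1 then oapp (b ord0) hi (insub k' : option 'I_n) else lo.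
have w_mono i j : (i < j <= n.+1)%N -> w i < w j.
  move=> /andP[]; case: i j => [|i] [|j]//=; rewrite !ltnS => ij jn.
    by case: insubP => [k _ _|_] /=; rewrite ?lob.
  case: insubP => [k kn ik|]; last by rewrite (leq_trans ij).
  case: insubP => [l _ jl|_] /=; last exact: bhi.
  by rewrite cb// ik jl.
have w_sgn k : (k <= n.+1)%N -> 0 < (-1) ^+ (n.+1 - k) * p.[w k].
  case: k => [_|k]; first by apply: pA; rewrite lerBlDr ler_wpDr ?bigmin_le_id.
  rewrite ltnS subSS => kn /=; case: insubP => [l _ <-|]; first exact: pb.
  rewrite -leqNgt => nk; rewrite (_ : (n - k = 0)%N) ?mul1r; last by lia.
  by apply: pB; rewrite le_max orbC ler_wpDr ?ler01// bigmax_ge_id.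
have [//|i|i j ij|i|a [ca _]] := @interlace_roots _ n.+1 p (fun i => w i) (fun i => w i.+1).
- by apply: w_mono; rewrite leqnn /= ltn_ord.
- move: ij; rewrite leq_eqVlt => /predU1P[->//|ij'].
  by apply/ltW/w_mono; rewrite ij' ltnW.
- have := w_sgn i (ltnW (ltn_ord i)); rewrite subSn; last by rewrite -ltnS.
  by move/sign_change; apply; exact: w_sgn i.+1 (ltn_ord i).
by rewrite (monicP pm) scale1r => pa; exists a.
Qed.

Lemma lead_coef_deriv_Ppoly (R : realType) n (a : 'rV[R]_n.+1) :
  lead_coef (Ppoly a)^`() = n.+1%:R /\ size (Ppoly a)^`() = n.+1.
Proof.
have s : size (Ppoly a)^`() = n.+1 by rewrite polyorder.size_deriv size_Ppoly.
split => //; rewrite /lead_coef s /= coef_deriv.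
by have := lead_coef_Ppoly a; rewrite /lead_coef size_Ppoly /= => ->.
Qed.

Lemma Ppoly_rolle (R : realType) n (a : 'rV[R]_n.+1) : conf R n.+1 a ->
  exists b : 'rV[R]_n, [/\ conf R n b, (Ppoly a)^`() = Qpoly n.+1 b &
    forall i : 'I_n, 0 < (-1) ^+ (n - i) * (Ppoly a).[b ord0 i]].
Proof.
move=> ca.
pose L (i : 'I_n) := widen_ord (leqnSn n) i; pose U (i : 'I_n) := lift ord0 i.
have roota i : (Ppoly a).[a ord0 i] = 0.
  by apply/eqP; rewrite -/(root _ _) root_Ppoly map_f// mem_enum.
have /fin_all_exists[r rP] : forall i, exists t,
    (a ord0 (L i) < t < a ord0 (U i)) && ((Ppoly a)^`().[t] == 0).
  move=> i; have [||t] := @polyrcf.poly_rolle _ (a ord0 (L i)) (a ord0 (U i)) (Ppoly a).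
  - by apply: ca; rewrite /= /bump.
  - by rewrite !roota.
  by rewrite in_itv => /= tuv rt; exists t; rewrite tuv rt eqxx.
have cr : conf R n (\row_i r i).
  move=> i j ij; rewrite !mxE.
  have /andP[/andP[_ ri] _] := rP i; have /andP[/andP[rj _] _] := rP j.
  by apply: lt_trans ri (le_lt_trans (conf_le ca _) rj); rewrite /= /bump.
have [lc s] := lead_coef_deriv_Ppoly a.
exists (\row_i r i); split => //.
  rewrite [LHS](conf_roots cr) ?lc// => i.
  by rewrite mxE; case/andP: (rP i).
move=> i; rewrite mxE; have /andP[/andP[ri ri'] _] := rP i.
(* Of the [n.+1] roots, the first [i.+1] lie to the left of [r i]. *)
rewrite (_ : n - i = n.+1 - i.+1)%N//; apply: Ppoly_sgn => j ij.
  by apply: le_lt_trans (conf_le ca _) ri; rewrite -ltnS.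
by apply: lt_le_trans ri' (conf_le ca _); rewrite /= /bump.
Qed.

(** Continuity of simple roots: the signs at [r ord0 k - d] and [r ord0 k + d] persist near the
    limit and trap one root between them. Pointwise convergence suffices, since only finitely many
    test points occur. *)
Lemma conf_cvg (R : realType) (T : Type) (F : set_system T) (FF : Filter F) n
    (f : T -> 'rV[R]_n) (r : 'rV[R]_n) :
  conf R n r -> (\forall x \near F, conf R n (f x)) ->
  (forall t, (Ppoly (f x)).[t] @[x --> F] --> (Ppoly r).[t]) ->
  f x @[x --> F] --> r.
Proof.
move=> cr cf fr; apply: cvg_rV => i; apply/cvgrPdist_lt => e e0.
pose P (ij : 'I_n * 'I_n) := (ij.1 < ij.2)%N.
(* At most [e], for the final estimate, and at most half of every gap, so that the intervals of
   radius [d] do not overlap. *)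
pose d := \big[Num.min/e]_(ij | P ij) ((r ord0 ij.2 - r ord0 ij.1) / 2).
have d0 : 0 < d.
  apply/bigmin_gtP; split => // -[k l] /= kl.
  by rewrite divr_gt0// subr_gt0 cr.
have de : d <= e by exact: bigmin_le_id.
have dr (k l : 'I_n) : (k < l)%N -> r ord0 k + d <= r ord0 l - d.
  move=> kl; suff : d <= (r ord0 l - r ord0 k) / 2 by lra.
  exact: (@bigmin_le_cond _ _ _ e (k, l) P
    (fun ij => (r ord0 ij.2 - r ord0 ij.1) / 2)).
have near_sgn : \forall x \near F, forall k,
    (Ppoly (f x)).[r ord0 k - d] * (Ppoly (f x)).[r ord0 k + d] < 0.
  apply: filter_forall => k.
  have lim_lt0 : (Ppoly r).[r ord0 k - d] * (Ppoly r).[r ord0 k + d] < 0.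
    have lo : 0 < (-1) ^+ (n - k) * (Ppoly r).[r ord0 k - d].
      apply: Ppoly_sgn => j kj; first by have := dr _ _ kj; lra.
      by have := conf_le cr kj; lra.
    have hi : 0 < (-1) ^+ (n - k.+1) * (Ppoly r).[r ord0 k + d].
      apply: Ppoly_sgn => j kj; last by have := dr _ _ kj; lra.
      by have /(conf_le cr) : (j <= k)%N by []; lra.
    by move: lo; rewrite -(subnSK (ltn_ord k)) => /sign_change; exact.
  by apply: (cvgr_lt _ _ _ lim_lt0); exact: cvgM.
near=> x.
have cfx : conf R n (f x) by near: x.
have sgx k : (Ppoly (f x)).[r ord0 k - d] * (Ppoly (f x)).[r ord0 k + d] < 0.
  by move: k; near: x.
have [|k|k l kl||a [ca ra]] := @interlace_roots _ n (Ppoly (f x))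
    (fun k => r ord0 k - d) (fun k => r ord0 k + d); rewrite ?size_Ppoly//.
- by lra.
- exact: dr.
(* The trapped roots form an increasing configuration with the same polynomial as [f x], so they are
   its coordinates in order. *)
rewrite lead_coef_Ppoly scale1r => /(Ppoly_inj cfx ca) ->.
by have := ra i; rewrite ltr_distlC => /andP[? ?]; apply/andP; split; lra.
Unshelve. all: by end_near. Qed.

(** * Critical values *)

Lemma Qpoly_inj (R : realType) n (b b' : 'rV[R]_n) :
  conf R n b -> conf R n b' -> Qpoly n.+1 b = Qpoly n.+1 b' -> b = b'.
Proof.
by move=> cb cb' /(scalerI (lt0r_neq0 (ltr0Sn R n)))/(Ppoly_inj cb cb').
Qed.

(** The choice made by [D] is forced, because [Qpoly] is injective on configurations. *)
Lemma D_eq (R : realType) n (a : 'rV[R]_n.+1) (b : 'rV[R]_n) :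
  conf R n b -> (Ppoly a)^`() = Qpoly n.+1 b -> D a = b.
Proof.
move=> cb ab; have [] : [set b : 'rV[R]_n | conf R n b /\
    (Ppoly a)^`() = Qpoly n.+1 b] (D a) by apply: getPex; exists b.
by move=> cD; rewrite ab => /esym /(Qpoly_inj cD cb).
Qed.

Lemma D_conf (R : realType) n (a : 'rV[R]_n.+1) : conf R n.+1 a ->
  [/\ conf R n (D a), (Ppoly a)^`() = Qpoly n.+1 (D a) &
    forall i : 'I_n, 0 < (-1) ^+ (n - i) * (Ppoly a).[D a ord0 i]].
Proof. by move=> /Ppoly_rolle[b [cb ab sb]]; rewrite (D_eq cb ab). Qed.

Lemma size_Qpoly (R : realType) n (b : 'rV[R]_n) : size (Qpoly n.+1 b) = n.+1.
Proof. by rewrite size_scale ?pnatr_eq0// size_Ppoly. Qed.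

(** The leading factor [n.+1] of [Qpoly] cancels the denominator produced by integration. *)
Lemma size_poly_int_Qpoly (R : realType) n (b : 'rV[R]_n) (c : R) :
  size (poly_int (Qpoly n.+1 b) + c%:P) = n.+2 /\
  poly_int (Qpoly n.+1 b) + c%:P \is monic.
Proof.
have lc : (poly_int (Qpoly n.+1 b))`_n.+1 = 1.
  rewrite coef_poly_int coefZ /=; have := lead_coef_Ppoly b.
  by rewrite lead_coefE size_Ppoly /= => ->; rewrite mulr1 divff// pnatr_eq0.
have s : size (poly_int (Qpoly n.+1 b)) = n.+2.
  rewrite /poly_int size_poly_eq ?size_Qpoly//=.
  by move: lc; rewrite coef_poly_int /= => ->; exact: oner_neq0.
have sc : (size c%:P < size (poly_int (Qpoly n.+1 b)))%N.
  by rewrite s (leq_ltn_trans (size_polyC_leq1 _)).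
by rewrite monicE lead_coefDl// lead_coefE size_polyDl// s/= lc eqxx.
Qed.

Lemma critvalE (R : realType) n (b : 'rV[R]_n.-1) i :
  critval n b i = (poly_int (Qpoly n b)).[b ord0 i].
Proof. exact: int0_horner. Qed.

(** The antiderivative is [X^2 - 2 b X]. Thus the separate clause for degree 2 agrees with the
    general maximum, and later arguments can treat all degrees alike. *)
Lemma critval2 (R : realType) (b : 'rV[R]_1) :
  critval 2 b ord0 = - (b ord0 ord0) ^+ 2.
Proof.
rewrite critvalE (_ : poly_int _ = 'X^2 - (2 * b ord0 ord0) *: 'X).
  by rewrite !hornerE; ring.
apply: deriv_eq_inj; last by rewrite poly_int0 !hornerE; ring.
rewrite deriv_poly_int derivB derivXn derivZ derivX /Qpoly big_ord1 /=.
by rewrite scalerBr -mul_polyC -!mul_polyC expr1 polyCM; ring.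
Qed.

Lemma mQE (R : realType) n (b : 'rV[R]_n.+1) : mQ n.+2 b =
  \big[maxe/-oo%E]_(i < n.+1 | ~~ odd (n.+1 - i.+1)) (critval n.+2 b i)%:E.
Proof.
case: n b => [|n] b //=.
by rewrite big_mkcond big_ord_recl big_ord0 /= critval2 maxeNy.
Qed.

Lemma MQE (R : realType) n (b : 'rV[R]_n.+1) : MQ n.+2 b =
  \big[mine/+oo%E]_(i < n.+1 | odd (n.+1 - i.+1)) (critval n.+2 b i)%:E.
Proof.
case: n b => [|n] b //=.
by rewrite big_mkcond big_ord_recl big_ord0 /= minxx.
Qed.

Lemma mQ_ltP (R : realType) n (b : 'rV[R]_n.+1) (y : \bar R) :
  (mQ n.+2 b < y)%E <-> (forall i : 'I_n.+1, ~~ odd (n.+1 - i.+1) ->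
    ((critval n.+2 b i)%:E < y)%E).
Proof.
rewrite mQE; split=> [/bigmax_ltP[]//|by_]; apply/bigmax_ltP; split => //.
(* The last index always enters the maximum, so [y] lies above a real number and hence above the
   neutral element. *)
apply: (lt_trans (ltNyr (critval n.+2 b ord_max))); apply: by_.
by rewrite /= subnn.
Qed.

Lemma MQ_gtP (R : realType) n (b : 'rV[R]_n.+1) (y : R) :
  (y%:E < MQ n.+2 b)%E <-> (forall i : 'I_n.+1, odd (n.+1 - i.+1) ->
    y < critval n.+2 b i).
Proof.
rewrite MQE; split=> [/bigmin_gtP[_ yb]//|yb].
by apply/bigmin_gtP; split => [|i oi]; rewrite ?ltry ?lte_fin// yb.
Qed.

Lemma mQ_fin (R : realType) n (b : 'rV[R]_n.+1) :
  mQ n.+2 b = (fine (mQ n.+2 b))%:E.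
Proof.
rewrite fineK// fin_numElt; apply/andP; split; last by apply/mQ_ltP => i _; exact: ltry.
rewrite mQE; apply: (lt_le_trans (ltNyr (critval n.+2 b ord_max))).
by apply: (le_bigmax_cond _ (fun i => (critval n.+2 b i)%:E)); rewrite /= subnn.
Qed.

Lemma MQ_fin (R : realType) n (b : 'rV[R]_n.+2) :
  MQ n.+3 b = (fine (MQ n.+3 b))%:E.
Proof.
rewrite fineK// fin_numElt MQE; apply/andP; split.
  by apply/bigmin_gtP; split => // i _; exact: ltNyr.
(* The penultimate index [n] enters the minimum, which is therefore finite. *)
apply: le_lt_trans (ltry (critval n.+3 b (inord n))).
apply: (bigmin_le_cond _ (fun i => (critval n.+3 b i)%:E)).
by rewrite inordK// subSS subSn// subnn.
Qed.

(** The exponent [n.+1 - i] is one more than the number whose parity selects [i] for the minimum or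
    the maximum. So an index of the minimum requires a positive value, an index of the maximum a
    negative one. *)
Lemma mQ_MQ_ltP (R : realType) n (b : 'rV[R]_n.+1) (c : R) :
  (mQ n.+2 b < (- c)%:E < MQ n.+2 b)%E <-> (forall i : 'I_n.+1,
    0 < (-1) ^+ (n.+1 - i) * (poly_int (Qpoly n.+2 b) + c%:P).[b ord0 i]).
Proof.
have sgn (i : 'I_n.+1) : (-1) ^+ (n.+1 - i) *
    (poly_int (Qpoly n.+2 b) + c%:P).[b ord0 i] =
    (if odd (n.+1 - i.+1) then 1 else -1) * (critval n.+2 b i + c).
  rewrite critvalE hornerD hornerC -signr_odd subSS subSn; last by rewrite -ltnS.
  by rewrite /=; case: odd.
split=> [/andP[/mQ_ltP mc /MQ_gtP cM] i|bc].
  rewrite sgn; case: ifPn => oi.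
    by have := cM i oi; lra.
  by have := mc i oi; rewrite lte_fin; lra.
apply/andP; split.
  by apply/mQ_ltP => i oi; have := bc i; rewrite sgn (negbTE oi) lte_fin; lra.
by apply/MQ_gtP => i oi; have := bc i; rewrite sgn oi; lra.
Qed.

Lemma D_mQ_MQ (R : realType) n (a : 'rV[R]_n.+2) : conf R n.+2 a ->
  (mQ n.+2 (D a) < (- (Ppoly a).[0])%:E < MQ n.+2 (D a))%E.
Proof.
move=> /D_conf[_ aQ sD]; apply/mQ_MQ_ltP => i.
by rewrite -aQ -poly_intE.
Qed.

Lemma exists_Ppoly (R : realType) n (b : 'rV[R]_n.+1) (c : R) :
  conf R n.+1 b -> (mQ n.+2 b < (- c)%:E < MQ n.+2 b)%E ->
  exists2 a : 'rV[R]_n.+2,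
    conf R n.+2 a & Ppoly a = poly_int (Qpoly n.+2 b) + c%:P.
Proof.
move=> cb /mQ_MQ_ltP bc; have [s m] := size_poly_int_Qpoly b c.
by have [a ca pa] := alternating_roots m s cb bc; exists a.
Qed.

(** * Rescaling the fibres to the unit interval *)

(* [Ev0 x] is by definition [level_of n (D x) (Ppoly x).[0]]. *)
Definition level_of (R : realType) n (b : 'rV[R]_n.-1) (c : R) : R :=
  let m := fine (mQ n b) in
  let M := fine (MQ n b) in
  if n == 2%N then (c + m) / (c + m - 1) else (c + M) / (M - m).
Arguments level_of {R} n b c.

(** The solution [c] of [level_of n b c = s]. In degree 2 it comes from [u / (u - 1)] being an
    involution in [u = c + m]; otherwise the equation is affine in [c]. *)
Definition const_of (R : realType) n (b : 'rV[R]_n.-1) (s : R) : R :=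
  let m := fine (mQ n b) in
  let M := fine (MQ n b) in
  if n == 2%N then s / (s - 1) - m else s * (M - m) - M.
Arguments const_of {R} n b s.

Lemma level_of_itv (R : realType) n (b : 'rV[R]_n.+1) (c : R) :
  (mQ n.+2 b < (- c)%:E < MQ n.+2 b)%E ->
  0 < level_of n.+2 b c < 1 /\ const_of n.+2 b (level_of n.+2 b c) = c.
Proof.
rewrite mQ_fin /level_of /const_of; case: n b => [|n] b.
  set m := fine (mQ 2 b); rewrite /= lte_fin => /andP[mc _].
  have c1 : c + m - 1 < 0 by lra.
  have c1' : c + m - 1 != 0 by rewrite ltr0_neq0.
  split; last first.
    rewrite (_ : (c + m) / (c + m - 1) - 1 = (c + m - 1)^-1); last by field.
    by rewrite invrK divfK// addrK.
  rewrite ltr_ndivlMr// ltr_ndivrMr// mul0r mul1r; lra.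
rewrite MQ_fin !lte_fin /=.
set m := fine _; set M := fine _ => /andP[mc cM].
have Mm : 0 < M - m by lra.
split; last by field; rewrite lt0r_neq0.
by rewrite ltr_pdivlMr// ltr_pdivrMr// mul0r mul1r; lra.
Qed.

(** Besides inverting [level_of], this supplies a constant strictly between [m(Q)] and [M(Q)],
    including when [M(Q)] is infinite. *)
Lemma const_of_sep (R : realType) n (b : 'rV[R]_n.+1) (s : R) :
  (mQ n.+2 b < MQ n.+2 b)%E -> 0 < s < 1 ->
  (mQ n.+2 b < (- const_of n.+2 b s)%:E < MQ n.+2 b)%E /\
  level_of n.+2 b (const_of n.+2 b s) = s.
Proof.
rewrite mQ_fin /level_of /const_of; case: n b => [|n] b.
  move=> _ /andP[s0 s1]; set m := fine (mQ 2 b); rewrite /= lte_fin ltry andbT.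
  have s1' : s - 1 != 0 by rewrite ltr0_neq0//; lra.
  split; last first.
    rewrite subrK (_ : s / (s - 1) - 1 = (s - 1)^-1); last by field.
    by rewrite invrK divfK.
  have : s / (s - 1) < 0 by rewrite pmulr_rlt0// invr_lt0; lra.
  lra.
rewrite MQ_fin !lte_fin /=.
set m := fine _; set M := fine _ => mM /andP[s0 s1].
have Mm : 0 < M - m by lra.
split; last by field; rewrite lt0r_neq0.
apply/andP; split; nra.
Qed.

(** * Continuity of critical values and of the rescaling *)

Lemma poly_cvg_int_Qpoly (R : realType) (T : Type) (F : set_system T)
    (FF : Filter F) n (f : T -> 'rV[R]_n) (b : 'rV[R]_n) :
  f x @[x --> F] --> b ->
  poly_cvg F (fun x => poly_int (Qpoly n.+1 (f x))) (poly_int (Qpoly n.+1 b)).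
Proof.
move=> fb; apply: poly_cvg_int; rewrite /Qpoly -mul_polyC.
under eq_fun do rewrite -mul_polyC.
by apply: poly_cvgM; [exact: poly_cvg_cst|exact: poly_cvg_Ppoly].
Qed.

Lemma size_int_Qpoly (R : realType) n (b : 'rV[R]_n) :
  size (poly_int (Qpoly n.+1 b)) = n.+2.
Proof. by have [] := size_poly_int_Qpoly b 0; rewrite addr0. Qed.

Lemma critval_cvg (R : realType) (T : Type) (F : set_system T)
    (FF : Filter F) n (f : T -> 'rV[R]_n) (b : 'rV[R]_n) i :
  f x @[x --> F] --> b ->
  critval n.+1 (f x) i @[x --> F] --> critval n.+1 b i.
Proof.
move=> fb; rewrite critvalE; under eq_fun do rewrite critvalE.
apply: (@poly_cvg_horner _ _ _ _ _ _ _ _ n.+2).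
- by move=> x; rewrite size_int_Qpoly.
- by rewrite size_int_Qpoly.
- exact: poly_cvg_int_Qpoly.
- exact: cvg_rV_coord.
Qed.

Lemma mQ_cvg (R : realType) (T : Type) (F : set_system T) (FF : Filter F) n
    (f : T -> 'rV[R]_n.+1) (b : 'rV[R]_n.+1) :
  f x @[x --> F] --> b -> mQ n.+2 (f x) @[x --> F] --> mQ n.+2 b.
Proof.
move=> fb; rewrite mQE; under eq_fun do rewrite mQE.
apply: cvg_big => [|i _]; first exact: max_continuous.
by apply: cvg_EFin; [exact: nearW|exact: critval_cvg].
Qed.

Lemma MQ_cvg (R : realType) (T : Type) (F : set_system T) (FF : Filter F) n
    (f : T -> 'rV[R]_n.+1) (b : 'rV[R]_n.+1) :
  f x @[x --> F] --> b -> MQ n.+2 (f x) @[x --> F] --> MQ n.+2 b.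
Proof.
move=> fb; rewrite MQE; under eq_fun do rewrite MQE.
apply: cvg_big => [|i _]; first exact: min_continuous.
by apply: cvg_EFin; [exact: nearW|exact: critval_cvg].
Qed.

(** The separation hypothesis keeps the limiting denominator nonzero: [c0 + m - 1 < 0] in degree 2,
    and [M - m > 0] above. *)
Lemma level_of_cvg (R : realType) (T : Type) (F : set_system T)
    (FF : Filter F) n (f : T -> 'rV[R]_n.+1) (b : 'rV[R]_n.+1)
    (c : T -> R) (c0 : R) :
  (mQ n.+2 b < (- c0)%:E < MQ n.+2 b)%E ->
  f x @[x --> F] --> b -> c x @[x --> F] --> c0 ->
  level_of n.+2 (f x) (c x) @[x --> F] --> level_of n.+2 b c0.
Proof.
move=> mcM fb cc0.
have mcvg : fine (mQ n.+2 (f x)) @[x --> F] --> fine (mQ n.+2 b).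
  by apply: fine_cvg; rewrite -mQ_fin; exact: mQ_cvg.
rewrite /level_of; case: n f b mcM fb mcvg => [|n] f b mcM fb mcvg.
  have ucvg : c x + fine (mQ 2 (f x)) @[x --> F] --> c0 + fine (mQ 2 b).
    exact: cvgD.
  apply: cvgM => //; apply: cvgV; last by apply: cvgB => //; exact: cvg_cst.
  by move: mcM; rewrite mQ_fin lte_fin => /andP[mc _]; rewrite ltr0_neq0//; lra.
have Mcvg : fine (MQ n.+3 (f x)) @[x --> F] --> fine (MQ n.+3 b).
  by apply: fine_cvg; rewrite -MQ_fin; exact: MQ_cvg.
apply: cvgM; first exact: cvgD.
apply: cvgV; last exact: cvgB.
by move: mcM; rewrite mQ_fin MQ_fin !lte_fin => ?; rewrite lt0r_neq0//; lra.
Qed.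

Lemma const_of_cvg (R : realType) (T : Type) (F : set_system T)
    (FF : Filter F) n (f : T -> 'rV[R]_n.+1) (b : 'rV[R]_n.+1)
    (s : T -> R) (s0 : R) :
  s0 < 1 -> f x @[x --> F] --> b -> s x @[x --> F] --> s0 ->
  const_of n.+2 (f x) (s x) @[x --> F] --> const_of n.+2 b s0.
Proof.
move=> s1 fb ss0.
have mcvg : fine (mQ n.+2 (f x)) @[x --> F] --> fine (mQ n.+2 b).
  by apply: fine_cvg; rewrite -mQ_fin; exact: mQ_cvg.
rewrite /const_of; case: n f b fb mcvg => [|n] f b fb mcvg.
  apply: cvgB => //; apply: cvgM => //.
  apply: cvgV; last by apply: cvgB => //; exact: cvg_cst.
  by rewrite subr_eq0 lt_eqF.
have Mcvg : fine (MQ n.+3 (f x)) @[x --> F] --> fine (MQ n.+3 b).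
  by apply: fine_cvg; rewrite -MQ_fin; exact: MQ_cvg.
by apply: cvgB => //; apply: cvgM => //; exact: cvgB.
Qed.

(** * The image of the derivative *)

Lemma QCE (R : realType) n : QC R n.+2 =
  [set b : 'rV[R]_n.+1 | conf R n.+1 b /\ (mQ n.+2 b < MQ n.+2 b)%E].
Proof.
apply/seteqP; split=> b /= [cb]; last first.
  move=> mM; split => //.
  (* Any level in the open unit interval would do; [1 / 2] selects one admissible constant. *)
  have [|/(exists_Ppoly cb)[a ca pa] _] := @const_of_sep _ _ b (1 / 2) mM.
    by apply/andP; split; lra.
  by exists a => //; rewrite pa derivD deriv_poly_int derivC addr0.
move=> [a ca /(D_eq cb) <-]; split; first by case: (D_conf ca).
by have /andP[] := D_mQ_MQ ca; exact: lt_trans.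
Qed.

Lemma D_image (R : realType) n : @D R n.+2 @` conf R n.+2 = QC R n.+2.
Proof.
apply/seteqP; split=> [_ [a ca <-]|b [cb [a ca ab]]].
  by have [cD aQ _] := D_conf ca; split => //; exists a.
by exists a => //; exact: D_eq.
Qed.

Lemma near_conf (R : realType) (T : Type) (F : set_system T) (FF : Filter F) n
    (f : T -> 'rV[R]_n) (b : 'rV[R]_n) :
  conf R n b -> f x @[x --> F] --> b -> \forall x \near F, conf R n (f x).
Proof.
move=> cb fb; apply: filter_forall => i; apply: filter_forall => j.
case: (boolP (i < j)%N) => [ij|_]; last exact: nearW.
have : \forall x \near F, f x ord0 i - f x ord0 j < 0.
  apply: (cvgr_lt (b ord0 i - b ord0 j)); last by rewrite subr_lt0 cb.
  by apply: cvgB; exact: cvg_rV_coord.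
by apply: filterS => x; rewrite subr_lt0.
Qed.

Lemma near_mQ_lt (R : realType) (T : Type) (F : set_system T) (FF : Filter F) n
    (f : T -> 'rV[R]_n.+1) (b : 'rV[R]_n.+1) (c : R) :
  (mQ n.+2 b < c%:E)%E -> f x @[x --> F] --> b ->
  \forall x \near F, (mQ n.+2 (f x) < c%:E)%E.
Proof.
move=> bc fb; under eq_near do rewrite mQ_fin lte_fin.
move: bc; rewrite mQ_fin lte_fin; apply: cvgr_lt => //.
by apply: fine_cvg; rewrite -mQ_fin; exact: mQ_cvg.
Qed.

Lemma near_MQ_gt (R : realType) (T : Type) (F : set_system T) (FF : Filter F) n
    (f : T -> 'rV[R]_n.+1) (b : 'rV[R]_n.+1) (c : R) :
  (c%:E < MQ n.+2 b)%E -> f x @[x --> F] --> b ->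
  \forall x \near F, (c%:E < MQ n.+2 (f x))%E.
Proof.
case: n f b => [|n] f b bc fb; first by apply: nearW => x; exact: ltry.
under eq_near do rewrite MQ_fin lte_fin.
move: bc; rewrite MQ_fin lte_fin; apply: cvgr_gt => //.
by apply: fine_cvg; rewrite -MQ_fin; exact: MQ_cvg.
Qed.

Lemma open_QC (R : realType) n : open (QC R n.+2).
Proof.
rewrite QCE openE => b [cb mM]; rewrite /interior /=.
have [|/andP[mc cM] _] := @const_of_sep _ _ b (1 / 2) mM.
  by apply/andP; split; lra.
(* A fixed real [c] between the two bounds reduces openness to two separate comparisons with a
   constant, one of which is trivial when [M(Q)] is infinite. *)
set c := - const_of _ _ _ in mc cM.
have idcvg : id x @[x --> nbhs b] --> b by exact: cvg_id.
apply: filterS3 (near_conf _ cb idcvg) (near_mQ_lt _ mc idcvg)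
  (near_MQ_gt _ cM idcvg) => x cx mx xM.
by split => //; exact: lt_trans mx xM.
Qed.

(** * Degrees in which every configuration is a derivative *)

(** By the mean value theorem the difference has the sign of [Q] between two consecutive roots. *)
Lemma critval_step (R : realType) n (b : 'rV[R]_n.+2) (i j : 'I_n.+2) :
  conf R n.+2 b -> j = i.+1 :> nat ->
  0 < (-1) ^+ (n.+2 - j) * (critval n.+3 b j - critval n.+3 b i).
Proof.
move=> cb ij; have bij : b ord0 i < b ord0 j by rewrite cb// ij.
rewrite !critvalE; have [t] := polyrcf.poly_mvt (poly_int (Qpoly n.+3 b)) bij.
rewrite in_itv => /= /andP[it tj] ->; rewrite deriv_poly_int hornerZ.
have : 0 < (-1) ^+ (n.+2 - j) * (Ppoly b).[t].
  apply: Ppoly_sgn => k; first by rewrite ij ltnS => /(conf_le cb); lra.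
  by move=> /(conf_le cb); lra.
move=> H; rewrite mulrA mulr_gt0 ?subr_gt0//.
by rewrite mulrCA mulr_gt0// ltr0Sn.
Qed.

(** With at most three critical points, each index of the maximum is adjacent to each index of the
    minimum, so consecutive comparisons decide everything. *)
Lemma QC_full (R : realType) n : (n <= 2)%N -> QC R n.+2 = conf R n.+1.
Proof.
move=> n2; rewrite QCE; apply/seteqP; split=> [b []//|b cb]; split=> //.
rewrite mQ_fin; apply/MQ_gtP => j oj; rewrite -lte_fin -mQ_fin.
apply/mQ_ltP => i oi; rewrite lte_fin.
case: n n2 b cb i j oi oj => [|[|[|//]]] _ b cb i j oi oj.
- by case: j oj => -[].
- have := critval_step cb (i := j) (j := i).
  by case: i oi => -[|[|]]//= ?; case: j oj => -[|[|]]//= ? _ _ /(_ erefl);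
    rewrite subSn// subnn expr1; lra.
- case: j oj => -[|[|[|]]]//= hj _; case: i oi => -[|[|[|]]]//= hi _.
    have := critval_step cb (i := Ordinal hi) (j := Ordinal hj) erefl.
    by rewrite /= expr2; lra.
  have := critval_step cb (i := Ordinal hj) (j := Ordinal hi) erefl.
  by rewrite /= expr1; lra.
Qed.

(* Degenerate critical points [0, ..., 0, 1, 1]: there [P' >= 0] on [0, 1], so
   the last critical value exceeds the one three places before.  This survives
   a small perturbation into a strictly increasing configuration. *)
Lemma QC_not_full (R : realType) n : QC R n.+4.+1 <> conf R n.+4.
Proof.
pose b0 : 'rV[R]_n.+4 := \row_i (if (i < n.+2)%N then 0 else 1).
pose b (e : R) : 'rV[R]_n.+4 := \row_i (b0 ord0 i + e *+ i).
pose j : 'I_n.+4 := inord n.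
have jn : j = n :> nat by rewrite inordK//; lia.
pose F (x : 'rV[R]_n.+4) := critval n.+4.+1 x ord_max - critval n.+4.+1 x j.
have F0 : 0 < F b0.
  rewrite /F !critvalE.
  have -> : b0 ord0 ord_max = 1 by rewrite mxE /= ltnNge; case: ifPn => //; lia.
  have -> : b0 ord0 j = 0 by rewrite mxE jn; case: ifPn => //; lia.
  have [t] := polyrcf.poly_mvt (poly_int (Qpoly n.+4.+1 b0)) (@ltr01 R).
  rewrite in_itv => /= /andP[t0 t1] ->; rewrite subr0 mulr1 deriv_poly_int.
  rewrite hornerZ mulr_gt0 ?ltr0Sn//.
  (* To the right of [t] lie only the two roots equal to 1, so the sign is positive. *)
  have := @Ppoly_sgn _ _ b0 n.+2 t.
  rewrite (_ : (n.+4 - n.+2)%N = 2%N); last by lia.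
  rewrite sqrrN expr1n mul1r.
  by apply=> k kn; rewrite mxE; rewrite ?kn// ltnNge kn.
have bcvg : b e @[e --> 0^'+] --> b0.
  apply: cvg_rV => i; under eq_fun do rewrite mxE.
  have : e *+ i @[e --> (0 : R)^'+] --> (0 : R) *+ i.
    by apply: cvgMn; apply: cvg_at_right_filter; exact: cvg_id.
  by rewrite mul0rn => /(cvgD (cvg_cst (b0 ord0 i))); rewrite addr0.
have [e [e0 Fe]] : exists e, 0 < e /\ 0 < F (b e).
  apply: (@filter_ex _ (0^'+)); near=> e; split.
    by near: e; exact: nbhs_right_gt.
  near: e; apply: (cvgr_gt _ _ _ F0).
  by apply: cvgB; exact: critval_cvg.
have cb : conf R n.+4 (b e).
  move=> k l kl; rewrite !mxE ler_ltD ?ltr_pMn2l//.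
  case: ifPn => // kn; first by case: ifP.
  by rewrite ifF//; apply/negbTE; move: kn; rewrite -!leqNgt => /leq_trans; apply; exact: ltnW.
(* The last index belongs to the maximum and [j], three places before it, to the minimum; [mQ < MQ]
   would make [F (b e)] negative. *)
move=> QCconf; have : conf R n.+4 (b e) by [].
rewrite -QCconf QCE => -[_]; rewrite mQ_fin => /MQ_gtP/(_ j).
rewrite jn -lte_fin -mQ_fin => H.
have /mQ_ltP/(_ ord_max) : (mQ n.+4.+1 (b e) < (critval n.+4.+1 (b e) j)%:E)%E.
  by apply: H; rewrite (_ : (n.+4 - n.+1)%N = 3%N)//; lia.
rewrite /= subnn lte_fin => /(_ isT).
by move: Fe; rewrite /F; lra.
Unshelve. all: by end_near. Qed.

(** * The homeomorphism *)

(** The inverse map: [const_of] recovers the constant term from the level, and the roots of the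
    resulting primitive are the configuration sought. *)
Definition primitive_at (R : realType) n (z : 'rV[R]_n.-1 * R) : 'rV[R]_n :=
  get [set a : 'rV[R]_n | conf R n a /\
    Ppoly a = poly_int (Qpoly n z.1) + (const_of n z.1 z.2)%:P].

Lemma primitive_atP (R : realType) n (z : 'rV[R]_n.+1 * R) :
  (QC R n.+2 `*` `]0, 1[) z ->
  conf R n.+2 (@primitive_at R n.+2 z) /\ Ppoly (@primitive_at R n.+2 z) =
    poly_int (Qpoly n.+2 z.1) + (const_of n.+2 z.1 z.2)%:P.
Proof.
case: z => b s [/=]; rewrite QCE in_itv => -[cb mM] /= s01.
have [/(exists_Ppoly cb)[a ca pa] _] := const_of_sep mM s01.
apply: (@getPex _ [set a : 'rV[R]_n.+2 | conf R n.+2 a /\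
  Ppoly a = poly_int (Qpoly n.+2 b) + (const_of n.+2 b s)%:P]).
by exists a.
Qed.

(** The entries of [D x] are the simple roots of a derivative whose coefficients vary continuously
    with [x], so [conf_cvg] applies. *)
Lemma D_cvg (R : realType) (T : Type) (F : set_system T) (FF : Filter F) n
    (f : T -> 'rV[R]_n.+1) (a : 'rV[R]_n.+1) :
  conf R n.+1 a -> (\forall x \near F, conf R n.+1 (f x)) ->
  f x @[x --> F] --> a -> D (f x) @[x --> F] --> D a.
Proof.
move=> ca cf fa; have [cD aQ _] := D_conf ca.
apply: conf_cvg => //; first by apply: filterS cf => x /D_conf[].
have PpolyD x : conf R n.+1 x -> Ppoly (D x) = n.+1%:R^-1 *: (Ppoly x)^`().
  by move=> /D_conf[_ -> _]; rewrite /Qpoly scalerA mulVf ?pnatr_eq0// scale1r.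
move=> t; rewrite (PpolyD a ca).
apply: (@cvg_trans _ ((n.+1%:R^-1 *: (Ppoly (f x))^`()).[t] @[x --> F])).
  by apply: near_eq_cvg; apply: filterS cf => x cx; rewrite PpolyD.
rewrite hornerZ; under eq_fun do rewrite hornerZ.
apply: cvgMl_tmp; apply: (@poly_cvg_horner _ _ _ _ _ _ _ _ n.+1).
- by move=> x; have [_ ->] := lead_coef_deriv_Ppoly (f x).
- by have [_ ->] := lead_coef_deriv_Ppoly a.
- by apply: poly_cvg_deriv; exact: poly_cvg_Ppoly.
- exact: cvg_cst.
Qed.

Lemma homeomorphism_D_Ev0 (R : realType) n :
  homeomorphism_on (conf R n.+2) (QC R n.+2 `*` (`]0, 1[ : set R))
    (fun x : 'rV[R]_n.+2 => (D x, Ev0 x)).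
Proof.
have Ev0E (x : 'rV[R]_n.+2) : Ev0 x = level_of n.+2 (D x) (Ppoly x).[0] by [].
have DP (z : 'rV[R]_n.+1 * R) : (QC R n.+2 `*` `]0, 1[) z ->
    (D (@primitive_at R n.+2 z), Ev0 (@primitive_at R n.+2 z)) = z.
  move=> Az; have [ca pa] := primitive_atP Az.
  case: z Az ca pa => b s; set a := primitive_at _; move=> [/=].
  rewrite QCE in_itv => -[cb mM] /= s01 ca pa.
  have Dab : D a = b.
    by apply: D_eq => //; rewrite pa derivD deriv_poly_int derivC addr0.
  rewrite Ev0E Dab pa hornerD poly_int0 hornerC add0r.
  by have [_ ->] := const_of_sep mM s01.
have DEv (x : 'rV[R]_n.+2) : conf R n.+2 x -> (QC R n.+2 `*` `]0, 1[) (D x, Ev0 x).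
  move=> cx; split => /=; first by rewrite -D_image; exists x.
  by rewrite in_itv /= Ev0E; have [] := level_of_itv (D_mQ_MQ cx).
split; first exact: DEv.
  apply/subspace_continuousP => x cx.
  have idcvg : id y @[y --> within (conf R n.+2) (nbhs x)] --> x.
    exact: cvg_within.
  have Dcvg : D y @[y --> within (conf R n.+2) (nbhs x)] --> D x.
    by apply: D_cvg => //; exact: withinT.
  apply: (@cvg_pair _ _ _ _ (nbhs (D x)) (nbhs (Ev0 x))) => //.
  apply: (@level_of_cvg _ _ _ _ _ _ (D x) (fun y => (Ppoly y).[0])) => //.
    exact: D_mQ_MQ.
  apply: (@poly_cvg_horner _ _ _ _ _ _ _ _ n.+3).
  - by move=> y; rewrite size_Ppoly.
  - by rewrite size_Ppoly.
  - exact: poly_cvg_Ppoly.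
  - exact: cvg_cst.
exists (@primitive_at R n.+2); split.
- by move=> z /primitive_atP[].
- apply/subspace_continuousP => z Az.
  set A := _ `*` _ in Az *.
  have nearA : \forall y \near within A (nbhs z), A y by exact: withinT.
  have [cz pz] := primitive_atP Az.
  (* Continuity of the inverse reduces to pointwise convergence of the primitives, that is, to
     continuity of [const_of]. *)
  apply: conf_cvg => //; first by apply: filterS nearA => y /primitive_atP[].
  move=> t; rewrite pz.
  apply: (@cvg_trans _ ((poly_int (Qpoly n.+2 y.1) +
      (const_of n.+2 y.1 y.2)%:P).[t] @[y --> within A (nbhs z)])).
    by apply: near_eq_cvg; apply: filterS nearA => y /primitive_atP[_ ->].
  have fstcvg : y.1 @[y --> within A (nbhs z)] --> z.1.
    by apply: cvg_within_filter; exact: cvg_fst.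
  have sndcvg : y.2 @[y --> within A (nbhs z)] --> z.2.
    by apply: cvg_within_filter; exact: cvg_snd.
  apply: (@poly_cvg_horner _ _ _ _ _ _ _ _ n.+3).
  + by move=> y; have [->] := size_poly_int_Qpoly y.1 (const_of n.+2 y.1 y.2).
  + by have [->] := size_poly_int_Qpoly z.1 (const_of n.+2 z.1 z.2).
  + apply: poly_cvgD; first exact: poly_cvg_int_Qpoly.
    apply: poly_cvgC; apply: const_of_cvg => //.
    by case: Az => _ /=; rewrite in_itv => /andP[].
  + exact: cvg_cst.
(* The rebuilt polynomial has the derivative and the constant term of [Ppoly x], so it has the same
   ordered roots. *)
- move=> x; rewrite inE => cx; have [cP pP] := primitive_atP (DEv x cx).
  apply: (Ppoly_inj cP cx); rewrite pP /= Ev0E.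
  have [_ ->] := level_of_itv (D_mQ_MQ cx).
  by have [_ <- _] := D_conf cx; rewrite -poly_intE.
- by move=> z; rewrite inE; exact: DP.
Qed.

Theorem theorem5p4 (R : realType) (n : nat) (hn : (2 <= n)%N) :
  (* a *)
  (forall x : 'rV[R]_n, conf R n x ->
     [/\ exists s : seq R,
           [/\ uniq s, size s = n.-1 & forall t, root (Ppoly x)^`() t = (t \in s)],
         conf R n.-1 (D x),
         (Ppoly x)^`() = Qpoly n (D x) &
         (mQ n (D x) < MQ n (D x))%E]) /\
  (* b *)
  ([/\ @D R n @` conf R n = QC R n,
       QC R n = [set b : 'rV[R]_n.-1 | conf R n.-1 b /\ (mQ n b < MQ n b)%E],
       open (QC R n : set (subspace (conf R n.-1))) &
       QC R n = conf R n.-1 <-> [\/ n = 2%N, n = 3%N | n = 4%N]]) /\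
  (* c *)
  homeomorphism_on (conf R n) (QC R n `*` (`]0, 1[ : set R))
    (fun x : 'rV[R]_n => (D x, Ev0 x)).
Proof.
case: n hn => [//|[//|n]] _; split; [|split].
- move=> x cx; have [cD xQ _] := D_conf cx; split => //; last first.
    by have /andP[] := D_mQ_MQ cx; exact: lt_trans.
  exists [seq D x ord0 i | i : 'I_n.+1]; split.
  + exact: lt_sorted_uniq (conf_sorted cD).
  + by rewrite size_map size_enum_ord.
  + by move=> t; rewrite xQ rootZ ?pnatr_eq0// root_Ppoly.
(* Openness among all row vectors gives openness relative to the configurations. *)
- split; [exact: D_image|exact: QCE|exact/open_subspaceW/open_QC|].
  split=> [|[] [n2]]; last 3 first.
  + by apply: QC_full; rewrite n2.
  + by apply: QC_full; rewrite n2.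
  + by apply: QC_full; rewrite n2.
  case: n => [|[|[|n]]] full; [by constructor 1|by constructor 2|by constructor 3|].
  by have := QC_not_full full.
- exact: homeomorphism_D_Ev0.
Qed.
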